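(* Let $H$ be a graph with $h$ edges and chromatic number $\chi(H)=r\geq 3$. If $k$ is an integer with $h\leq k\leq h+\lfloor r/2\rfloor-1$ and $n$ is sufficiently large, then $\mathrm{ex}_k(n,H)=(h-1)\binom{n}{2}$, and the unique $n$-vertex $k$-color extremal multigraph of $H$ consists of exactly $h-1$ colors each of which is a copy of $K_n$ (the remaining colors being empty).
   Context: A multigraph is loopless with possibly parallel edges; $e(G)$ counts edges with multiplicity. A simple $k$-coloring of a multigraph $G$ is a decomposition of its edge multiset as a disjoint sum of $k$ simple graphs on $V(G)$ (colors). A subgraph is multicolored if its edges receive pairwise distinct colors. $\mathrm{ex}_k(n,H)$ is the maximum number of edges of an $n$-vertex multigraph admitting a simple $k$-coloring with no multicolored copy of $H$; the maximizers (with such colorings) are the $k$-color extremal multigraphs. *)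

(* Defs.v *)
From HB Require Import structures.
From mathcomp Require Import all_boot.

Set Implicit Arguments.
Unset Strict Implicit.
Unset Printing Implicit Defensive.

Record sgraph (V : finType) := SGraph {
  edges : {set {set V}};
  edges_card2 : [forall e in edges, #|e| == 2] }.

HB.instance Definition _ (V : finType) := [isSub for @edges V].
HB.instance Definition _ (V : finType) := [Finite of sgraph V by <:].

Lemma complete_card2 (V : finType) :
  [forall e in [set e : {set V} | #|e| == 2], #|e| == 2].
Proof. by apply/forall_inP => e; rewrite inE. Qed.

Definition complete_graph (V : finType) : sgraph V := SGraph (complete_card2 V).

Lemma empty_card2 (V : finType) :
  [forall e in set0 : {set {set V}}, #|e| == 2].
Proof. by apply/forall_inP => e; rewrite inE. Qed.

Definition empty_graph (V : finType) : sgraph V := SGraph (empty_card2 V).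

Definition colorable (W : finType) (H : sgraph W) (q : nat) : bool :=
  [exists f : {ffun W -> 'I_q},
    [forall x, forall y, ([set x; y] \in edges H) ==> (f x != f y)]].

Lemma colorable_ex (W : finType) (H : sgraph W) : exists q, colorable H q.
Proof.
exists #|W|; apply/existsP; exists [ffun x => enum_rank x].
apply/forallP=> x; apply/forallP=> y; apply/implyP=> xyH.
rewrite !ffunE (inj_eq enum_rank_inj); apply/eqP=> xy.
have /forall_inP/(_ _ xyH) := edges_card2 H.
by rewrite xy setUid cards1.
Qed.

Definition chromatic_number (W : finType) (H : sgraph W) : nat :=
  ex_minn (colorable_ex H).

(* [mult G e] is the number of parallel edges joining the two elements of [e];
   the condition excludes loops (and every other set not of size 2). *)
Record multigraph (V : finType) := Multigraph {
  mult : {ffun {set V} -> nat};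
  mult_card2 : [forall e, (mult e != 0) ==> (#|e| == 2)] }.

Definition num_edges (V : finType) (G : multigraph V) : nat :=
  \sum_(e : {set V}) mult G e.

Lemma disjoint_sum_card2 (V : finType) k (c : {ffun 'I_k -> sgraph V}) :
  let m := [ffun e : {set V} => \sum_(i < k) (e \in edges (c i))] in
  [forall e, (m e != 0) ==> (#|e| == 2)].
Proof.
apply/forallP=> e; rewrite ffunE; apply/implyP; rewrite sum_nat_eq0.
case/forallPn=> i; rewrite implyTb eqb0 negbK => ei.
by have /forall_inP/(_ _ ei) := edges_card2 (c i).
Qed.

Definition disjoint_sum (V : finType) k (c : {ffun 'I_k -> sgraph V}) :
  multigraph V := Multigraph (disjoint_sum_card2 c).

Definition simple_coloring (V : finType) k
    (G : multigraph V) (c : {ffun 'I_k -> sgraph V}) : Prop :=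
  G = disjoint_sum c.

(* An edge of the multigraph is a pair (2-set, color class containing it), so a
   multicolored copy of H is an embedding f of its vertices together with an
   injective choice g of a color for each of its edges. *)
Definition has_multicolored (V W : finType) k
    (c : {ffun 'I_k -> sgraph V}) (H : sgraph W) : bool :=
  [exists f : {ffun W -> V}, exists g : {ffun {e | e \in edges H} -> 'I_k},
    [&& injectiveb f, injectiveb g
      & [forall e : {e | e \in edges H}, f @: val e \in edges (c (g e))]]].

(* A multigraph is determined by a simple coloring of it, so the maximum can be
   taken over the finitely many colorings; see [exk_upper] and [exk_attained]. *)
Definition exk (k n : nat) (W : finType) (H : sgraph W) : nat :=
  \max_(c : {ffun 'I_k -> sgraph 'I_n} | ~~ has_multicolored c H)
    num_edges (disjoint_sum c).

Lemma exk_upper k n (W : finType) (H : sgraph W) (G : multigraph 'I_n)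
    (c : {ffun 'I_k -> sgraph 'I_n}) :
  simple_coloring G c -> ~~ has_multicolored c H -> num_edges G <= exk k n H.
Proof. by move=> -> cH; exact: (@leq_bigmax_cond _ _ (fun c => num_edges (disjoint_sum c)) _ cH). Qed.

Lemma exk_attained k n (W : finType) (H : sgraph W) :
    0 < #|edges H| ->
  exists (G : multigraph 'I_n) (c : {ffun 'I_k -> sgraph 'I_n}),
    [/\ simple_coloring G c, ~~ has_multicolored c H & num_edges G = exk k n H].
Proof.
case/card_gt0P=> e0 e0H.
pose c0 : {ffun 'I_k -> sgraph 'I_n} := [ffun=> empty_graph 'I_n].
have c0P : ~~ has_multicolored c0 H.
  apply/existsP=> -[f /existsP[g /and3P[_ _ /forallP/(_ (exist _ e0 e0H))]]].
  by rewrite ffunE inE.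
have : 0 < #|[pred c : {ffun 'I_k -> sgraph 'I_n} | ~~ has_multicolored c H]|.
  by apply/card_gt0P; exists c0; rewrite inE.
case/(eq_bigmax_cond (fun c => num_edges (disjoint_sum c))) => c cP exE.
by exists (disjoint_sum c), c; split; rewrite // /exk exE.
Qed.

Definition extremal_coloring k n (W : finType) (H : sgraph W)
    (G : multigraph 'I_n) (c : {ffun 'I_k -> sgraph 'I_n}) : Prop :=
  [/\ simple_coloring G c, ~~ has_multicolored c H & num_edges G = exk k n H].

Definition extremal_multigraph k n (W : finType) (H : sgraph W)
    (G : multigraph 'I_n) : Prop :=
  exists c : {ffun 'I_k -> sgraph 'I_n}, extremal_coloring H G c.

(* Main.v *)
(* Put p = h - 1 and q = k - p <= r / 2, and call a pair heavy if its multiplicity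
   exceeds p.  An injection of V(H) yields a multicolored H as soon as, for every
   x, at most x edges of H land on pairs of multiplicity at most x: color the edges
   in increasing order of multiplicity.

   Let every degree be at least p (n - 1) and let some pair be heavy.  If few
   vertices have linearly many heavy neighbors, all other vertices have few
   neighbors of multiplicity below p, so some heavy pair lies in a clique of
   multiplicities at least p, and H embeds there.  Otherwise there is a large
   complete bipartite graph of heavy pairs.  By averaging and pigeonhole it extends
   part by part to a complete r-partite structure in which part b sends total
   multiplicity at least b p to the earlier parts; since every two classes of an
   optimal coloring of H span an edge, the bound q <= r / 2 gives the condition above.

   So no pair is heavy once the minimum degree is large; deleting vertices of small
   degree reduces to this case.  In the extremal case all multiplicities equal p,
   and adjacent pairs with different color sets would give a multicolored H. *)
Require Import Defs.
From mathcomp Require Import all_boot perm zify.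

Set Implicit Arguments.
Unset Strict Implicit.
Unset Printing Implicit Defensive.

(** * Greedy choice, pigeonhole and averaging in finite sets *)

(** The element [e] with the longest list chooses last: the hypothesis at [#|L e|] gives
    [#|D| <= #|L e|], so the other choices cannot exhaust its list. The color [c0] is only a default
    for the total function [g]. *)
Lemma greedy_transversal (T C : finType) (c0 : C) (D : {set T})
    (L : T -> {set C}) :
  (forall x, #|[set e in D | #|L e| <= x]| <= x) ->
  exists g : T -> C,
    {in D &, injective g} /\ (forall e, e \in D -> g e \in L e).
Proof.
have [n] := ubnP #|D|; elim: n D => // n IHn D ltDn hallD.
have [->|[e0 e0D]] := set_0Vmem D.
  by exists (fun=> c0); split=> [x y|x]; rewrite inE.
have [e eD maxe] : exists2 e, e \in D & forall y, y \in D -> #|L y| <= #|L e|.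
  by case: (arg_maxnP (fun e => #|L e|) e0D) => e; exists e.
have cardD := cardsD1 e D; rewrite eD in cardD.
have [|x|g [injg gL]] := IHn (D :\ e).
- by lia.
- apply: leq_trans (hallD x); apply/subset_leq_card/subsetP=> y.
  by rewrite !inE => /andP[/andP[_ ->]].
have leDL : #|D| <= #|L e|.
  apply: leq_trans (hallD #|L e|); apply/subset_leq_card/subsetP=> y yD.
  by rewrite inE yD maxe.
have /subsetPn[c cL cg] : ~~ (L e \subset g @: (D :\ e)).
  apply/negP=> /subset_leq_card; have := leq_imset_card g (D :\ e); lia.
exists (fun y => if y == e then c else g y); split=> [x y xD yD|y yD].
  case: (eqVneq x e) (eqVneq y e) => [->|xe] [->|ye] // => [cgy|gxc|].
  - by case/imsetP: cg; exists y; rewrite // !inE ye.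
  - by case/imsetP: cg; exists x; rewrite // !inE xe.
  - by apply: injg; rewrite !inE ?xe ?ye.
by case: eqVneq => [->//|ye]; apply: gL; rewrite !inE ye.
Qed.

Lemma exists_subset_card (T : finType) (A : {set T}) t :
  t <= #|A| -> exists2 B : {set T}, B \subset A & #|B| = t.
Proof.
move=> tA; have [s [szs us sA]] : exists s : seq T,
    [/\ size s = t, uniq s & {subset s <= A}].
  exists (take t (enum A)); split; first by rewrite size_takel -?cardE.
    by rewrite take_uniq ?enum_uniq.
  by move=> x /mem_take; rewrite mem_enum.
exists [set x in s]; first by apply/subsetP=> x; rewrite inE => /sA.
by rewrite cardsE; move/card_uniqP: us => ->.
Qed.

Lemma pigeonhole_set (T R : finType) (f : T -> R) (A : {set T}) (I : {pred R}) t :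
  (forall x, x \in A -> f x \in I) -> #|I| * t < #|A| ->
  exists B : {set T}, [/\ B \subset A, #|B| = t & {in B &, forall x y, f x = f y}].
Proof.
move=> fI ltA.
have [/existsP[i ti]|] := boolP [exists i, t <= #|[set x in A | f x == i]|].
  have [B BA cB] := exists_subset_card ti; exists B; split=> //.
    by apply/(subset_trans BA)/subsetP=> x; rewrite inE => /andP[].
  move=> x y /(subsetP BA) + /(subsetP BA).
  by rewrite !inE => /andP[_ /eqP->] /andP[_ /eqP->].
rewrite negb_exists => /forallP small; move: ltA.
rewrite ltnNge -sum1_card (partition_big f (mem I)) //=.
case/negP; rewrite -sum_nat_const; apply: leq_sum => i _.
by rewrite sum1dep_card ltnW // ltnNge.
Qed.

Lemma uniform_subset (V : finType) (k t u : nat) (f : V -> V -> nat) (U A : {set V}) :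
  (forall x y, f x y <= k) -> #|U| <= u -> k.+1 ^ u * t < #|A| ->
  exists B : {set V}, [/\ B \subset A, #|B| = t &
    forall x y z, x \in U -> y \in B -> z \in B -> f x y = f x z].
Proof.
move=> fk leU ltA.
(* [F y] is the profile of [y] on [U]. Being constant outside [U], the profiles number at most
   [k.+1 ^ #|U|]. *)
pose F y : {ffun V -> 'I_k.+1} := [ffun x => if x \in U then inord (f x y) else ord0].
have [| |B [BA cB FB]] := @pigeonhole_set V _ F A
  (mem (pffun_on ord0 (mem U) (mem [set: 'I_k.+1]))) t.
- move=> y _; apply/pffun_onP; split=> [|x]; last by rewrite inE.
  by apply/supportP=> x xU; rewrite ffunE (negbTE xU).
- apply: leq_ltn_trans ltA; rewrite card_pffun_on leq_mul2r cardsT card_ord.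
  by rewrite leq_pexp2l ?leU ?orbT.
exists B; split=> // x y z xU yB zB.
have /ffunP/(_ x) := FB _ _ yB zB; rewrite !ffunE xU => /(congr1 val).
by rewrite /= !inordK // ltnS.
Qed.

Lemma sum_card_set (V : finType) (X : {set V}) (Q : pred V) :
  \sum_(x in X) Q x = #|[set x in X | Q x]|.
Proof.
by rewrite -sum1dep_card big_mkcondr; apply: eq_bigr => x _; case: (Q x).
Qed.

Lemma card_bigcup_le (I V : finType) (A : {pred I}) (F : I -> {set V}) :
  #|\bigcup_(i in A) F i| <= \sum_(i in A) #|F i|.
Proof.
apply: (big_ind2 (fun (B : {set V}) n => #|B| <= n)) => [|B b C c leB leC|//].
  by rewrite cards0.
by rewrite (leq_trans (leq_card_setU B C)) ?leq_add.
Qed.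

(** A point of [X] outside both [U] and the desired set falls short of [theta] by at least 1, while
    any other contributes at most [M]. With only [g + u] others, the total deficit would exceed the
    slack [c]. *)
Lemma many_above_average (V : finType) (X U : {set V}) (F : V -> nat)
    (M theta c u g : nat) :
  (forall v, v \in X -> F v <= M) -> #|U| <= u ->
  theta * #|X| <= \sum_(v in X) F v + c ->
  (g + u) * M.+1 + c < #|X| ->
  g < #|[set v in X :\: U | theta <= F v]|.
Proof.
move=> FM leU avg ltX; set A := [set v in _ | _]; rewrite ltnNge; apply/negP=> leA.
have: \sum_(v in X) (F v + 1) <= \sum_(v in X) (theta + M.+1 * (v \in A :|: U)).
  apply: leq_sum => v vX; rewrite !inE vX andbT.
  by case: (v \in U); case: (leqP theta (F v)) => /=; have := FM v vX; lia.
rewrite !big_split /= !sum_nat_const -big_distrr /=.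
have: \sum_(v in X) (v \in A :|: U) <= #|A| + #|U|.
  rewrite -big_mkcondr sum1_card -cardsUI; apply: leq_trans (leq_addr _ _).
  by apply/subset_leq_card/subsetP=> x /andP[].
nia.
Qed.

(** * Edges and optimal vertex colorings *)

Lemma imset_pair (T R : finType) (f : T -> R) x y :
  f @: [set x; y] = [set f x; f y].
Proof. by rewrite imsetU !imset_set1. Qed.

Lemma edgeP (W : finType) (H : sgraph W) e :
  e \in edges H -> exists x y, x != y /\ e = [set x; y].
Proof.
by move=> eH; have /forall_inP/(_ _ eH)/cards2P[x [y [xy ->]]] := edges_card2 H; exists x, y.
Qed.

Lemma edge_neq (W : finType) (H : sgraph W) x y :
  [set x; y] \in edges H -> x != y.
Proof.
move=> xyH; have /forall_inP/(_ _ xyH) := edges_card2 H.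
by rewrite cards2; case: (x != y).
Qed.

(** Two color classes spanning no edge could be merged, saving a color. *)
Lemma optimal_coloring (W : finType) (H : sgraph W) r :
  chromatic_number H = r ->
  exists phi : W -> 'I_r,
    (forall x y, [set x; y] \in edges H -> phi x != phi y) /\
    (forall a b, a != b ->
       exists x y, [/\ [set x; y] \in edges H, phi x = a & phi y = b]).
Proof.
rewrite /chromatic_number; case: ex_minnP => q colq minq eqr; subst q.
have /existsP[phi /forallP phiH] := colq; exists phi.
have phiE x y : [set x; y] \in edges H -> phi x != phi y.
  by move=> xyH; have /forallP/(_ y)/implyP/(_ xyH) := phiH x.
split=> // a b ab.
have [/existsP[x /existsP[y /and3P[xyH /eqP xa /eqP yb]]]|/existsPn noE] :=
  boolP [exists x, exists y, [&& [set x; y] \in edges H, phi x == a & phi y == b]].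
  by exists x, y.
case: r => [|r] in a b ab phi colq minq phiH phiE noE *; first by case: (a).
have [a' ea] : exists a', unlift b a = Some a'.
  rewrite eq_sym in ab; have [a' _ ->] := unlift_some ab; by exists a'.
suff /minq : colorable H r by rewrite ltnn.
(* [unlift b] renumbers the palette without [b]; vertices colored [b] receive [a'], the new number
   of [a]. *)
apply/existsP; exists [ffun x => odflt a' (unlift b (phi x))].
have {}noE x y : [set x; y] \in edges H -> phi x = a -> phi y = b -> False.
  move=> xyH xa yb; have /existsP[] := noE x; exists y.
  by rewrite xyH xa yb !eqxx.
apply/forallP=> x; apply/forallP=> y; apply/implyP=> xyH; rewrite !ffunE.
have := phiE _ _ xyH.
have := noE x y xyH; have := noE y x; rewrite setUC => /(_ xyH).
case: (unliftP b (phi x)) => [x' ex|->]; case: (unliftP b (phi y)) => [y' ey|->] //=.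
- by rewrite ex ey (inj_eq lift_inj).
- move=> _ nx _; apply/eqP=> ?; subst x'; apply: nx => //.
  by rewrite ex; case: unliftP ea => // a'' -> [<-].
- move=> ny _ _; apply/eqP=> ?; subst y'; apply: ny => //.
  by rewrite ey; case: unliftP ea => // a'' -> [<-].
by rewrite eqxx.
Qed.

(** Without two edges sharing a vertex the graph is a matching, which is 2-colorable: color each
    vertex according to whether its partner has larger rank. *)
Lemma adjacent_edges (W : finType) (H : sgraph W) :
  2 < chromatic_number H ->
  exists a b c, [/\ b != c, [set a; b] \in edges H & [set a; c] \in edges H].
Proof.
rewrite /chromatic_number; case: ex_minnP => q _ minq q2.
have [/existsP[a /existsP[b /existsP[c /and3P[? ? ?]]]]|/existsPn noE] :=
  boolP [exists a, exists b, exists c,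
    [&& b != c, [set a; b] \in edges H & [set a; c] \in edges H]].
  by exists a, b, c.
have {}noE a b c : [set a; b] \in edges H -> [set a; c] \in edges H -> b = c.
  move=> abH acH; apply/eqP; have /existsPn/(_ b)/existsPn/(_ c) := noE a.
  by rewrite abH acH !andbT negbK.
suff /minq : colorable H 2 by rewrite leqNgt q2.
pose up x := [exists y, ([set x; y] \in edges H) && (enum_rank x < enum_rank y)].
apply/existsP; exists [ffun x => if up x then ord0 else ord_max : 'I_2].
apply/forallP=> x; apply/forallP=> y; apply/implyP=> xyH; rewrite !ffunE.
have yxH := xyH; rewrite setUC in yxH.
have upE a b : [set a; b] \in edges H -> up a = (enum_rank a < enum_rank b).
  move=> abH; apply/existsP/idP => [[c /andP[acH]]|]; first by rewrite (noE _ _ _ abH acH).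
  by exists b; rewrite abH.
rewrite (upE _ _ xyH) (upE _ _ yxH).
have : enum_rank x != enum_rank y :> nat.
  by apply: contraTneq (edge_neq xyH) => /val_inj/enum_rank_inj->; rewrite eqxx.
by case: ltngtP.
Qed.

(** * Greedy embeddings, and embedding into a clique *)

(** The counting condition is the hypothesis of [greedy_transversal] for the lists of colors on the
    image edges, whose sizes are the multiplicities. *)
Definition greedy_embedding (V W : finType) (m : {set V} -> nat) (H : sgraph W)
    (f : W -> V) : Prop :=
  injective f /\ forall x, #|[set e in edges H | m (f @: e) <= x]| <= x.

Lemma injection_extending (V W : finType) (C : {set V}) (s : seq W) (g : W -> V) :
  #|W| <= #|C| -> uniq s -> {in s &, injective g} -> {in s, forall x, g x \in C} ->
  exists f : W -> V, [/\ injective f, forall x, f x \in C & {in s, f =1 g}].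
Proof.
move=> WC; elim: s => [|x s IHs] /=.
  move=> _ _ _; have [W0|[w _]] := set_0Vmem [set: W].
    by exists g; split=> // x; have := in_setT x; rewrite W0 inE.
  have lt_rank (x : W) : enum_rank x < size (enum C).
    by rewrite -cardE; apply: leq_trans WC; apply: ltn_ord.
  have v0 : V by case: (enum C) (lt_rank w).
  exists (fun x => nth v0 (enum C) (enum_rank x)); split=> // [x y /eqP|x].
    by rewrite nth_uniq ?enum_uniq // => /eqP/val_inj/enum_rank_inj.
  by rewrite -mem_enum mem_nth.
case/andP=> xs us injg gC.
case: IHs => // [y z ys zs|y ys|f [injf fC fg]].
- by apply: injg; rewrite inE ?ys ?zs orbT.
- by apply: gC; rewrite inE ys orbT.
have gxC : g x \in C by rewrite gC ?mem_head.
(* Swapping [f x] with [g x] corrects the value at [x], stays inside [C], and moves no value already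
   prescribed on [s]. *)
exists (tperm (f x) (g x) \o f); split=> [|y|y] /=.
- exact: inj_comp (@perm_inj _ _) injf.
- by case: tpermP.
rewrite inE => /predU1P[->|ys]; first by rewrite tpermL.
have yx : y != x by apply: contraNneq xs => <-.
rewrite tpermD; [exact: fg | by rewrite (inj_eq injf) eq_sym |].
rewrite (fg y ys); apply: contraNneq yx => gxy; apply/eqP/injg => //; rewrite ?mem_head //.
by rewrite inE ys orbT.
Qed.

(** One edge of [H] is sent to the heavy pair and the rest anywhere in [C]. No image has
    multiplicity below [p], and at most [p] of the [p.+1] images have multiplicity exactly [p]. *)
Lemma clique_embedding (V W : finType) (m : {set V} -> nat) (H : sgraph W)
    (C : {set V}) (u v : V) (p : nat) :
  #|edges H| = p.+1 -> #|W| <= #|C| -> u \in C -> v \in C -> u != v ->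
  p < m [set u; v] -> {in C &, forall x y, x != y -> p <= m [set x; y]} ->
  exists f : W -> V, greedy_embedding m H f.
Proof.
move=> cH WC uC vC uv heavy mC.
have /card_gt0P[e0 e0H] : 0 < #|edges H| by rewrite cH.
have [a [b [ab e0E]]] := edgeP e0H.
have [|||f [injf fC fg]] :=
    @injection_extending V W C [:: a; b] (fun x => if x == a then u else v) WC.
- by rewrite /= inE ab.
- move=> x y; rewrite !inE => /orP[]/eqP-> /orP[]/eqP->; rewrite ?eqxx //;
    rewrite eq_sym (negbTE ab) => /eqP; rewrite ?(negbTE uv) //.
  by rewrite eq_sym (negbTE uv).
- by move=> x _; case: ifP.
have fa : f a = u by rewrite fg ?eqxx // mem_head.
have fb : f b = v by rewrite fg ?inE ?eqxx ?orbT // eq_sym (negbTE ab).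
exists f; split=> // x.
have [ltpx|lexp] := ltnP p x.
  apply: leq_trans ltpx; rewrite -cH; apply/subset_leq_card/subsetP=> e.
  by rewrite inE => /andP[].
have pe e : e \in edges H -> p <= m (f @: e).
  move=> /edgeP[y [z [yz ->]]]; rewrite imset_pair mC //.
  by rewrite (inj_eq injf).
have [eqxp|neqxp] := eqVneq x p; last first.
  rewrite (_ : [set e in _ | _] = set0) ?cards0 //.
  apply/setP=> e; rewrite !inE; apply/negP=> /andP[eH].
  have := pe _ eH; lia.
subst x; have := cardsD1 e0 (edges H); rewrite e0H cH => -[cD].
rewrite [X in _ <= X]cD; apply/subset_leq_card/subsetP=> e.
rewrite !inE => /andP[-> le_p]; rewrite andbT.
by apply: contraTneq le_p => ->; rewrite e0E imset_pair fa fb -ltnNge.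
Qed.

(** * Weighted complete multipartite structures *)

(** A balanced complete [s]-partite structure with weights on the pairs of parts; [w a b] is
    meaningful only for [a < b < s]. *)
Definition grid (V : finType) (m : {set V} -> nat) (X : {set V}) (s t : nat)
    (P : nat -> {set V}) (w : nat -> nat -> nat) : Prop :=
  [/\ forall a, a < s -> P a \subset X /\ #|P a| = t,
      forall a b, a < b -> b < s -> [disjoint P a & P b]
    & forall a b x y, a < b -> b < s -> x \in P a -> y \in P b ->
        w a b <= m [set x; y]].

Definition grid_weights (k p s : nat) (w : nat -> nat -> nat) : Prop :=
  [/\ p < w 0 1,
      forall b, 0 < b -> b < s -> b * p <= \sum_(a < b) w a b
    & forall a b, a < b -> b < s -> w a b <= k].

Lemma sum_pairs_below (r : nat) : 2 * (\sum_(b < r) b) + r = r * r.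
Proof.
elim: r => [|r IHr]; first by rewrite big_ord0.
by rewrite big_ord_recr /=; move: (\sum_(_ < r) _) IHr => T; lia.
Qed.

(** Bounding a weight by [x], or by [k] if it exceeds [x], gives [b * (p - x) <= (k - x) * M b],
    where [M b] counts the weights above [x] in row [b]. Both alternatives failing contradicts the
    sum of these inequalities together with the one for a row that has a weight at most [x]. *)
Lemma grid_weights_count (k p r x : nat) (w : nat -> nat -> nat) :
  1 < r -> 2 * (k - p) <= r -> grid_weights k p r w -> x <= p ->
  (forall a b, a < b -> b < r -> x < w a b) \/
  p - x < \sum_(b < r) \sum_(a < b) (x < w a b).
Proof.
move=> r1 q2 [heavy sumw wk] lexp.
pose M b := \sum_(a < b) (x < w a b).
have lepk : p <= k by have := wk 0 1 isT r1; lia.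
have rowM b : b < r -> b * (p - x) <= (k - x) * M b.
  case: (posnP b) => [->//|b0] br.
  have : \sum_(a < b) w a b <= \sum_(a < b) (x + (k - x) * (x < w a b)).
    by apply: leq_sum => a _; have := wk a b (ltn_ord a) br; case: ltnP => /=; lia.
  rewrite big_split /= sum_nat_const card_ord -big_distrr /= -/(M b).
  have := sumw b b0 br; rewrite mulnBr.
  by move: (\sum_(a < b) w a b) (M b) => A B; nia.
have M1 : M 1 = 1 by rewrite /M big_ord1 /=; lia.
have [allw|/forallPn[b /forallPn[a lewx]]] :=
    boolP [forall b : 'I_r, forall a : 'I_b, x < w a b].
  left=> a b ab br.
  by have /forallP/(_ (Ordinal br))/forallP/(_ (Ordinal ab)) := allw.
right; rewrite ltnNge; apply/negP=> leM.
have ltMb : M b < b.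
  rewrite /M (bigD1 a) //= (negbTE lewx) add0n.
  have : \sum_(i < b | i != a) (x < w i b) <= \sum_(i < b | i != a) 1.
    by apply: leq_sum => i _; case: (x < _).
  rewrite sum1_card cardC1 card_ord; have := ltn_ord a.
  by move: (\sum_(i < b | _) _) => A; lia.
have := rowM b (ltn_ord b).
(* The extra [k - p] comes from row 1: its single weight is heavy, so its inequality has slack
   [(k - x) - (p - x)]. *)
have : (p - x) * (\sum_(i < r) i) + (k - p) <= (k - x) * \sum_(i < r) M i.
  rewrite !big_distrr /=; pose i1 := Ordinal r1.
  rewrite (bigD1 i1) //= [X in _ <= X](bigD1 i1) //= M1.
  have : \sum_(i < r | i != i1) (p - x) * i <= \sum_(i < r | i != i1) (k - x) * M i.
    by apply: leq_sum => i _; rewrite mulnC rowM.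
  by move: (\sum_(i < r | _) _) (\sum_(i < r | _) _) => A B; lia.
have := sum_pairs_below r; have := ltn_ord b; move: leM; rewrite -/M.
set S := \sum_(i < r) M i; set T := \sum_(i < r) i.
set j := p - x; have -> : k - x = k - p + j by lia.
have q0 : 0 < k - p by have := wk 0 1 isT r1; lia.
move: (k - p) q2 q0 => q q2 q0 leS br eqT Hsum Hb.
have [j0|j0] := posnP j; first by nia.
have le_jS : (q + j) * S <= (q + j) * j by rewrite leq_mul2l leS orbT.
have Tj : T < q + j.
  rewrite -(ltn_pmul2l j0) mulnC [j * _]mulnC; nia.
have le_b : (q + j) * M b <= (q + j) * b.-1 by rewrite leq_mul2l; lia.
(* The deficient row yields [j <= (r - 2) * q]. Then [T < q + j <= (r - 1) * q], whereas
   [2 * q <= r] makes the last term at most [T], the number of pairs of parts. *)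
have jb : j <= b.-1 * q by nia.
have jr : j <= (r - 2) * q by apply: leq_trans jb _; rewrite leq_mul2r; lia.
nia.
Qed.

Lemma grid_map (V W : finType) (m : {set V} -> nat) (X : {set V}) (r : nat)
    (P : nat -> {set V}) (w : nat -> nat -> nat) (phi : W -> 'I_r) :
  grid m X r #|W| P w ->
  exists f : W -> V, injective f /\ forall x, f x \in P (phi x).
Proof.
case=> PX disj _.
(* An empty [W] is treated apart, since then [V] need not contain a default vertex for [nth]. *)
have [W0|[w0 _]] := set_0Vmem [set: W].
  have noW (x : W) : False by have := in_setT x; rewrite W0 inE.
  exists (fun x => False_rect V (noW x)).
  by split=> [x|x]; case: (noW x).
have lt_rank (x : W) a : a < r -> enum_rank x < size (enum (P a)).
  by rewrite -cardE => /PX[_ ->]; apply: ltn_ord.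
have v0 : V by case: (enum _) (lt_rank w0 _ (ltn_ord (phi w0))).
pose f x := nth v0 (enum (P (phi x))) (enum_rank x).
have fP x : f x \in P (phi x) by rewrite -mem_enum mem_nth ?lt_rank.
have disjF a b x : a < r -> b < r -> x \in P a -> x \in P b -> a = b.
  move=> ar br xa xb; case: (ltngtP a b) => // ab.
    by have /disjointFr/(_ xa) := disj _ _ ab br; rewrite xb.
  by have /disjointFr/(_ xb) := disj _ _ ab ar; rewrite xa.
exists f; split=> // x y fxy.
have phixy : phi x = phi y :> nat.
  by apply: (disjF _ _ (f x)) => //; rewrite fxy.
move: fxy; rewrite /f phixy => /eqP.
by rewrite nth_uniq ?enum_uniq ?lt_rank // => /eqP/val_inj/enum_rank_inj.
Qed.

(** Each class of an optimal coloring goes to its own part. Every two classes span an edge, so each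
    pair of parts of weight above [x] accounts for an edge with image multiplicity above [x]; more
    than [p - x] such edges leave at most [x] of the [p.+1] below. *)
Lemma grid_embedding (V W : finType) (m : {set V} -> nat) (H : sgraph W)
    (X : {set V}) (k p r : nat) (P : nat -> {set V}) (w : nat -> nat -> nat) :
  chromatic_number H = r -> 1 < r -> #|edges H| = p.+1 -> 2 * (k - p) <= r ->
  grid m X r #|W| P w -> grid_weights k p r w ->
  exists f : W -> V, greedy_embedding m H f.
Proof.
move=> chiH r1 cH q2 gridP wP.
have [phi [phiH phiE]] := optimal_coloring chiH.
have [f [injf fP]] := grid_map phi gridP.
exists f; split=> // x; have [_ _ mP] := gridP.
have [ltpx|lexp] := ltnP p x.
  apply: leq_trans ltpx; rewrite -cH; apply/subset_leq_card/subsetP=> e.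
  by rewrite inE => /andP[].
pose Ex := [set e in edges H | x < m (f @: e)].
have cEx : #|[set e in edges H | m (f @: e) <= x]| + #|Ex| = p.+1.
  rewrite -cH -(cardsID [set e : {set W} | m (f @: e) <= x] (edges H)).
  by congr (_ + _); apply: eq_card => e; rewrite !inE // -ltnNge andbC.
have wm (a b : 'I_r) : a < b -> exists2 e, e \in edges H &
    phi @: e = [set a; b] /\ w a b <= m (f @: e).
  move=> ab; have /phiE[y [z [yzH ya zb]]] : a != b.
    by apply: contraTneq ab => ->; rewrite ltnn.
  exists [set y; z] => //; rewrite !imset_pair ya zb; split=> //.
  by apply: mP => //; [rewrite -ya|rewrite -zb].
case: (grid_weights_count r1 q2 wP lexp) => [allw|ltpw].
  rewrite (_ : [set e in _ | _] = set0) ?cards0 //.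
  apply/setP=> e; rewrite !inE; apply/negP=> /andP[eH le_x].
  have [y [z [_ eyz]]] := edgeP eH; subst e.
  have := phiH _ _ eH; rewrite -val_eqE neq_ltn; move: le_x.
  rewrite imset_pair leqNgt => /negP le_x /orP[]ltyz; apply: le_x.
    exact: leq_trans (allw _ _ ltyz (ltn_ord _)) (mP _ _ _ _ ltyz (ltn_ord _) (fP _) (fP _)).
  rewrite setUC.
  exact: leq_trans (allw _ _ ltyz (ltn_ord _)) (mP _ _ _ _ ltyz (ltn_ord _) (fP _) (fP _)).
pose Pr := [set ab : 'I_r * 'I_r | (ab.2 < ab.1) && (x < w ab.2 ab.1)].
have cPr : #|Pr| = \sum_(b < r) \sum_(a < b) (x < w a b).
  rewrite -sum1dep_card big_mkcond /= -(pair_bigA _ (fun b a : 'I_r =>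
    if (a < b) && (x < w a b) then 1 else 0)) /=.
  apply: eq_bigr => b _.
  rewrite (big_ord_widen r (fun a => (x < w a b) : nat) (ltnW (ltn_ord b))).
  by rewrite [RHS]big_mkcond; apply: eq_bigr => a _; case: (a < b); case: (x < _).
suff : #|Pr| <= #|Ex| by lia.
(* The color set [phi @: e] recovers the pair of parts, so different pairs are witnessed by
   different edges. *)
have inj2 : {in Pr &, injective (fun ab : 'I_r * 'I_r => [set ab.2; ab.1])}.
  move=> [b a] [d c]; rewrite !inE /= => /andP[ab _] /andP[cd _] /setP eqS.
  have := eqS a; have := eqS b; have := eqS c; have := eqS d.
  rewrite !inE !eqxx ?orbT -!val_eqE /= => h1 h2 h3 h4.
  by congr (_, _); apply: val_inj => /=; lia.
rewrite -(card_in_imset inj2).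
apply: leq_trans (leq_imset_card (fun e : {set W} => phi @: e) Ex).
apply/subset_leq_card/subsetP=> _ /imsetP[[b a] + ->]; rewrite !inE /= => /andP[ab xw].
have [e eH [<- we]] := wm _ _ ab; apply: imset_f.
by rewrite inE eH (leq_trans xw).
Qed.

(** * Many heavy vertices produce a grid *)

Definition min_degree_ge (V : finType) (m : {set V} -> nat) (X : {set V}) (p : nat) : Prop :=
  forall v, v \in X -> p * #|X|.-1 <= \sum_(x in X) m [set v; x].

Definition heavy_neighbors (V : finType) (m : {set V} -> nat) (X : {set V}) (p : nat) (v : V) :=
  [set x in X | p < m [set v; x]].

(** For positive [E], these are the vertices with at least [#|X| / E] heavy neighbors, written
    without division. *)
Definition heavy_vertices (V : finType) (m : {set V} -> nat) (X : {set V}) (p E : nat) :=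
  [set v in X | #|X| <= E * #|heavy_neighbors m X p v|].

Lemma choice_below (T : Type) (R : nat -> T -> Prop) (s : nat) (y0 : T) :
  (forall a, a < s -> exists y, R a y) ->
  exists F : nat -> T, forall a, a < s -> R a (F a).
Proof.
elim: s => [|s IHs] exR; first by exists (fun=> y0).
have [|F FR] := IHs; first by move=> a /ltnW; apply: exR.
have [y Ry] := exR s (ltnSn s).
exists (fun a => if a == s then y else F a) => a; rewrite ltnS leq_eqVlt.
by case: eqVneq => [->|] //= _; apply: FR.
Qed.

(** Take the largest level [c] reached by at least [t] elements: fewer than [t] elements exceed it
    when [c < k], and none when [c = k], so replacing [g] by [c] loses at most [t * k] in the
    sum. *)
Lemma popular_level (V : finType) (P : {set V}) (g : V -> nat) (k t : nat) :
  (forall x, g x <= k) -> t <= #|P| ->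
  exists Qc : {set V} * nat, [/\ Qc.1 \subset P, #|Qc.1| = t, Qc.2 <= k,
    forall x, x \in Qc.1 -> Qc.2 <= g x & \sum_(x in P) g x <= Qc.2 * #|P| + t * k].
Proof.
move=> gk tP; pose A i := [set x in P | i <= g x].
have ex0 : exists i, (i <= k) && (t <= #|A i|).
  exists 0; rewrite /= (leq_trans tP) //; apply/subset_leq_card/subsetP=> x xP.
  by rewrite inE xP.
have ub i : (i <= k) && (t <= #|A i|) -> i <= k by case/andP.
case: (ex_maxnP ex0 ub) => c /andP[ck tA] maxc.
have [Q QA cQ] := exists_subset_card tA.
exists (Q, c); split=> //=.
- by apply/(subset_trans QA)/subsetP=> x; rewrite inE => /andP[].
- by move=> x /(subsetP QA); rewrite inE => /andP[].
have : \sum_(x in P) g x <= \sum_(x in P) (c + k * (c < g x)).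
  by apply: leq_sum => x _; have := gk x; case: ltnP => /=; lia.
rewrite big_split /= sum_nat_const -big_distrr /= mulnC.
rewrite (sum_card_set P (fun x => c < g x)) -/(A c.+1).
suff : k * #|A c.+1| <= t * k by lia.
rewrite mulnC leq_mul2r; have [ltck|] := ltnP c k.
  case: (leqP t #|A c.+1|) => [tA1|/ltnW->]; last by rewrite orbT.
  by have := maxc c.+1; rewrite ltck tA1 ltnn => /(_ isT).
move=> kc; rewrite (_ : A c.+1 = set0) ?cards0 ?orbT //.
by apply/setP=> x; rewrite !inE; apply/negP=> /andP[_]; have := gk x; lia.
Qed.

(** By averaging, many vertices outside the parts send total multiplicity at least [s * T * p] into
    them. Pigeonhole selects [t] of these with identical profiles, and [popular_level] shrinks each
    part to one where the multiplicity towards them has a common lower bound. *)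
Lemma extend_parts (k p s t : nat) : 0 < t ->
  exists T N, 0 < T /\ forall (V : finType) (m : {set V} -> nat) (X : {set V})
      (P : nat -> {set V}),
    (forall e, m e <= k) -> min_degree_ge m X p -> N <= #|X| ->
    (forall a, a < s -> P a \subset X /\ #|P a| = T) ->
    exists (Q : nat -> {set V}) (w : nat -> nat) (B : {set V}),
      [/\ B \subset X, #|B| = t, s * p <= \sum_(a < s) w a
        & forall a, a < s -> [/\ [disjoint P a & B], Q a \subset P a, #|Q a| = t,
            w a <= k & forall x y, x \in Q a -> y \in B -> w a <= m [set x; y]]].
Proof.
(* [T] exceeds the total loss [s * t * k] of the [s] uses of [popular_level], so after division by
   [T] the weights still sum to at least [s * p]. [g] is what [uniform_subset] requires. *)
move=> t0; pose T := s * t * k + t; pose g := k.+1 ^ (s * T) * t.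
exists T, ((g + s * T) * (s * T * k).+1 + s * T * p).+1; split; first by lia.
move=> V m X P mk degX ltX XP.
pose U := \bigcup_(a < s) P a.
pose F v := \sum_(a < s) \sum_(x in P a) m [set x; v].
have leU : #|U| <= s * T.
  apply: leq_trans (card_bigcup_le _ _) _; rewrite -[s in s * T](card_ord s) -sum_nat_const.
  by apply: leq_sum => a _; have [_ ->] := XP _ (ltn_ord a).
have FM v : v \in X -> F v <= s * T * k.
  move=> _; rewrite -[s in s * T](card_ord s) -mulnA -sum_nat_const.
  apply: leq_sum => a _; have [_ <-] := XP _ (ltn_ord a).
  by rewrite -sum_nat_const; apply: leq_sum => x _.
have sumF : s * T * p * #|X| <= \sum_(v in X) F v + s * T * p.
  have : s * T * (p * #|X|.-1) <= \sum_(v in X) F v.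
    rewrite /F exchange_big /= -[s in s * T](card_ord s) -mulnA -sum_nat_const.
    apply: leq_sum => a _; have [PX <-] := XP _ (ltn_ord a).
    rewrite exchange_big /= -sum_nat_const; apply: leq_sum => x xP.
    exact/degX/(subsetP PX).
  by move: (\sum_(v in X) F v) => S; nia.
have := many_above_average FM leU sumF ltX.
set A := [set v in _ | _] => ltA.
have [B [BA cB unifB]] :=
  @uniform_subset V k t (s * T) (fun x y => m [set x; y]) U A (fun x y => mk _) leU ltA.
have BXU y : y \in B -> y \in X :\: U.
  by move/(subsetP BA); rewrite inE => /andP[].
have /card_gt0P[v0 v0B] : 0 < #|B| by rewrite cB.
have [] := @choice_below _ (fun a (Qc : {set V} * nat) =>
    [/\ Qc.1 \subset P a, #|Qc.1| = t, Qc.2 <= k,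
    forall x, x \in Qc.1 -> Qc.2 <= m [set x; v0]
    & \sum_(x in P a) m [set x; v0] <= Qc.2 * T + t * k]) s (set0, 0).
  move=> a /XP[_ cP]; rewrite -cP; apply: popular_level => [x|]; first exact: mk.
  by rewrite cP /T leq_addl.
move=> Qw QwP; exists (fun a => (Qw a).1), (fun a => (Qw a).2), B.
have PU a x : a < s -> x \in P a -> x \in U.
  by move=> as_ xP; apply/bigcupP; exists (Ordinal as_).
split=> //.
- by apply/subsetP=> y /BXU; rewrite inE => /andP[].
- have : F v0 <= \sum_(a < s) ((Qw a).2 * T + t * k).
    by apply: leq_sum => a _; have [] := QwP _ (ltn_ord a).
  rewrite big_split /= -big_distrl /= sum_nat_const card_ord.
  have : s * T * p <= F v0 by move/(subsetP BA): v0B; rewrite inE => /andP[].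
  move: (F v0) (\sum_(a < s) _) => f S h1 h2; rewrite leqNgt; apply/negP=> ltS.
  have : T * S.+1 <= T * (s * p) by rewrite leq_mul2l ltS orbT.
  by rewrite /T in h1 h2 *; nia.
move=> a as_; have [QP cQ wk wm _] := QwP _ as_; split=> //.
  rewrite disjoint_subset; apply/subsetP=> x xP; rewrite inE; apply/negP=> /BXU.
  by rewrite inE (PU a).
move=> x y xQ yB; rewrite (unifB x y v0) ?wm // (PU a) //.
exact: (subsetP QP).
Qed.

(** Induction on the number of parts. The base is a complete bipartite structure of heavy pairs,
    found by double counting; the step asks for larger parts and appends the set given by
    [extend_parts]. *)
Lemma heavy_grid_exists (k p E s t : nat) : p < k -> 0 < t ->
  exists N, forall (V : finType) (m : {set V} -> nat) (X : {set V}),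
    (forall e, m e <= k) -> min_degree_ge m X p -> N <= #|X| ->
    N <= #|heavy_vertices m X p E| ->
    exists P w, grid m X s.+2 t P w /\ grid_weights k p s.+2 w.
Proof.
move=> pk; elim: s t => [|s IHs] t t0.
  (* Each of [E * t] heavy vertices is joined heavily to a fraction [1 / E] of [X], so a vertex of
     [X] has on average at least [t] heavy neighbors among them. *)
  pose T := E * t; pose g := 2 ^ T * t.
  exists ((g + T) * T.+1).+1 => V m X mk _ ltX leZ.
  have [Z0 Z0Z cZ0] : exists2 Z0 : {set V}, Z0 \subset heavy_vertices m X p E & #|Z0| = T.
    apply: exists_subset_card; apply: leq_trans leZ; rewrite /T; nia.
  have Z0X : Z0 \subset X.
    by apply/(subset_trans Z0Z)/subsetP=> x; rewrite inE => /andP[].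
  pose F v := \sum_(x in Z0) (p < m [set x; v]).
  have FM v : v \in X -> F v <= T.
    move=> _; rewrite /F -cZ0 -sum1_card; apply: leq_sum => x _.
    by case: (p < _).
  have sumF : t * #|X| <= \sum_(v in X) F v + 0.
    have : #|X| * T <= E * \sum_(v in X) F v.
      rewrite /F exchange_big /= big_distrr /= -cZ0 mulnC -sum_nat_const.
      apply: leq_sum => x /(subsetP Z0Z); rewrite inE => /andP[_].
      by rewrite (sum_card_set X (fun v => p < m [set x; v])).
    move=> leE; have [E0|E0] := posnP E.
      move: leZ; rewrite /heavy_vertices E0.
      case: (set_0Vmem X) ltX => [->|[x xX] ltX]; first by rewrite cards0.
      rewrite (_ : [set v in X | _] = set0) ?cards0 //.
      by apply/setP=> v; rewrite !inE mul0n; apply/negP=> /andP[_]; lia.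
    rewrite addn0 -(leq_pmul2l E0); apply: leq_trans leE.
    by rewrite mulnA mulnC -/T.
  have leZ0 : #|Z0| <= T by rewrite cZ0.
  have ltX' : (g + T) * T.+1 + 0 < #|X| by rewrite addn0.
  have := many_above_average FM leZ0 sumF ltX'.
  set A := [set v in _ | _] => ltA.
  have [B [BA cB unifB]] := @uniform_subset V 1 t T
    (fun x y => p < m [set x; y]) Z0 A (fun x y => leq_b1 _) leZ0 ltA.
  have /card_gt0P[v0 v0B] : 0 < #|B| by rewrite cB.
  have : t <= F v0 by move/(subsetP BA): v0B; rewrite inE => /andP[].
  rewrite /F (sum_card_set Z0 (fun x => p < m [set x; v0])).
  case/exists_subset_card=> Q /subsetP QZ cQ.
  have BXZ y : y \in B -> (y \in X) && (y \notin Z0).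
    by move/(subsetP BA); rewrite !inE => /andP[/andP[-> ->]].
  exists (fun a => if a == 0 then Q else B), (fun _ _ => p.+1).
  split; split=> //.
  - move=> [|[|a]] //= _; split=> //; apply/subsetP=> x.
      by move/QZ; rewrite inE => /andP[/(subsetP Z0X)].
    by case/BXZ/andP.
  - move=> [|a] [|[|b]] //= _ _; rewrite disjoint_subset; apply/subsetP=> x /QZ.
    by rewrite !inE => /andP[xZ _]; apply/negP=> /BXZ; rewrite xZ andbF.
  - move=> [|a] [|[|b]] x y //= _ _ xQ yB; have := QZ _ xQ; rewrite inE => /andP[xZ].
    by have /= := unifB x y v0 xZ yB v0B; do 2!case: (p < _).
  - by move=> [|[|b]] // _ _; rewrite big_ord1 mul1n.
have [T [N1 [T0 ext]]] := @extend_parts k p s.+2 t t0.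
have [N2 grid2] := IHs T T0.
exists (N1 + N2) => V m X mk degX leX leZ.
have [||P [w [[PX disjP mP] [heavy sumw wk]]]] := grid2 V m X mk degX; try lia.
have [|Q [w0 [B [BX cB sumw0 QP]]]] := ext V m X P mk degX _ PX; first by lia.
(* The new part takes the last index [s.+2]; the earlier parts only shrink, so their old weights
   remain valid. *)
pose P' a := if a < s.+2 then Q a else B.
pose w' a b := if b < s.+2 then w a b else w0 a.
exists P', w'; rewrite /P' /w'; split; split=> //.
- move=> a _; case: ltnP => // /[dup] /PX[PXa _] /QP[_ QPa cQ _ _].
  by split=> //; apply: subset_trans QPa PXa.
- move=> a b ab bs; rewrite (leq_trans ab) ?(ltnSE bs) //.
  have as_ : a < s.+2 by lia.
  have [PB QPa _ _ _] := QP a as_.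
  case: ltnP => bs2; last exact: disjointWl QPa PB.
  have [_ QPb _ _ _] := QP b bs2.
  exact: disjointW QPa QPb (disjP _ _ ab bs2).
- move=> a b x y ab bs; have as_ : a < s.+2 by lia.
  have [_ QPa _ _ wm] := QP a as_; rewrite as_.
  case: ltnP => bs2; last exact: wm.
  have [_ QPb _ _ _] := QP b bs2 => /(subsetP QPa) xP /(subsetP QPb) yP.
  exact: mP.
- move=> b b0; rewrite ltnS => bs; case: ltnP => bs2; first exact: sumw.
  by have -> : b = s.+2 by lia.
- move=> a b ab bs; case: ltnP => bs2; first exact: wk.
  by have [] : _ := QP a (leq_trans ab (ltnSE bs)).
Qed.

(** * Few heavy vertices produce a clique *)

(** Each neighbor of multiplicity below [p] costs the degree at least 1, which only heavy neighbors
    can repay, each by at most [k]; and [y] has fewer than [#|X| / E] of those. *)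
Lemma few_light_neighbors (V : finType) (m : {set V} -> nat) (X : {set V})
    (k p E : nat) (y : V) :
  (forall e, m e <= k) -> min_degree_ge m X p ->
  y \in X :\: heavy_vertices m X p E ->
  E * #|[set x in X | m [set y; x] < p]| <= E * p + k * #|X|.
Proof.
move=> mk degX; rewrite !inE => /andP[+ yX]; rewrite yX /= -ltnNge => ltH.
have cX : 0 < #|X| by apply/card_gt0P; exists y.
have : \sum_(x in X) (m [set y; x] + (m [set y; x] < p))
     <= \sum_(x in X) (p + k * (p < m [set y; x])).
  by apply: leq_sum => x _; have := mk [set y; x]; do 2!case: ltngtP => /=; lia.
rewrite !big_split /= sum_nat_const -big_distrr /=.
rewrite (sum_card_set X (fun x => m [set y; x] < p)).
rewrite (sum_card_set X (fun x => p < m [set y; x])).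
have := degX y yX; move: ltH; rewrite /heavy_neighbors.
move: #|[set x in X | p < _]| #|[set x in X | _ < p]| (\sum_(x in X) _) => h l S.
nia.
Qed.

Lemma many_neighbors (V : finType) (m : {set V} -> nat) (X : {set V})
    (k p : nat) (u : V) :
  0 < p -> (forall e, m e <= k) -> min_degree_ge m X p -> u \in X ->
  #|X| <= p + k * #|[set y in X | p <= m [set u; y]]|.
Proof.
move=> p0 mk degX uX.
have cX : 0 < #|X| by apply/card_gt0P; exists u.
have : \sum_(x in X) (m [set u; x] + 1) <= \sum_(x in X) (p + k * (p <= m [set u; x])).
  by apply: leq_sum => x _; have := mk [set u; x]; case: leqP => /=; lia.
rewrite !big_split /= !sum_nat_const -big_distrr /=.
rewrite (sum_card_set X (fun x => p <= m [set u; x])).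
have := degX u uX.
move: #|[set x in X | p <= _]| (\sum_(x in X) _) => h S.
nia.
Qed.

(** Starting from a heavy pair [u], [v] with [v] outside [Z], the clique grows by vertices outside
    [Z]. Only [u] may be a heavy vertex, and then its good neighbors are merely about [#|X| / k] in
    number; each other clique vertex rules out only about [k * #|X| / E] candidates. *)
Lemma few_heavy_clique (k p c : nat) : 0 < p -> p < k ->
  exists E, forall T, exists N, forall (V : finType) (m : {set V} -> nat)
      (X : {set V}) (u0 v0 : V),
    (forall e, m e <= k) -> (forall x, m [set x] = 0) -> min_degree_ge m X p ->
    N <= #|X| -> #|heavy_vertices m X p E| < T ->
    u0 \in X -> v0 \in X -> p < m [set u0; v0] ->
    exists (C : {set V}) (u v : V), [/\ c <= #|C|, u \in C, v \in C, u != v &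
      p < m [set u; v] /\ {in C &, forall x y, x != y -> p <= m [set x; y]}].
Proof.
(* This [E] makes the at most [c.+1] exclusions of size about [k * #|X| / E] total less than
   [#|X| / k]. *)
move=> p0 pk; have [E eqE] : exists E, E = k * k * c.+1 + 1 by exists (k * k * c.+1 + 1).
have E0 : 0 < E by rewrite eqE addn1.
exists E => T.
exists (E * p + k * (E * T + c.+1 * (E * p)) + E * T).+1.
move=> V m X u0 v0 mk m1 degX leX ltZ u0X v0X heavy0.
set Z := heavy_vertices m X p E in ltZ.
have msym x y : m [set x; y] = m [set y; x] by rewrite setUC.
have [u [v [uX vXZ heavy]]] : exists u v, [/\ u \in X, v \in X :\: Z & p < m [set u; v]].
  have [v0Z|v0Z] := boolP (v0 \in Z); last by exists u0, v0; rewrite inE v0Z.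
  have [u0Z|u0Z] := boolP (u0 \in Z); last by exists v0, u0; rewrite inE u0Z msym.
  move: (u0Z); rewrite inE u0X /= => leH.
  (* If both ends lie in [Z], then [u0] has more than [T] heavy neighbors, too many to fit in
     [Z]. *)
  have /subsetPn[v] : ~~ (heavy_neighbors m X p u0 \subset Z).
    apply/negP=> /subset_leq_card leHZ; nia.
  by rewrite inE => /andP[vX ltv] vZ; exists u0, v; rewrite inE vZ.
have neq x y : 0 < m [set x; y] -> x != y.
  by apply: contraTneq => ->; rewrite setUid m1.
have uv : u != v by apply: neq; lia.
pose Y := [set y in X | p <= m [set u; y]].
have leY : #|X| <= p + k * #|Y| by apply: many_neighbors.
suff /(_ c (leqnn c))[C [cC uC vC _ [_ mC]]] : forall i, i <= c ->
    exists C : {set V}, [/\ #|C| = i.+2, u \in C, v \in C, C :\ u \subset X :\: Z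
      & C \subset X /\ {in C &, forall x y, x != y -> p <= m [set x; y]}].
  by exists C, u, v; split=> //; lia.
have vX : v \in X by move: vXZ; rewrite inE => /andP[].
elim=> [_|i IHi ltic].
  exists [set u; v]; rewrite cards2 uv !inE !eqxx orbT; split=> //.
    by apply/subsetP=> x; rewrite in_setD1 in_set2 => /andP[/negbTE-> /= /eqP->].
  split; first by apply/subsetP=> x; rewrite !inE => /orP[]/eqP->.
  move=> x y; rewrite !inE => /orP[]/eqP-> /orP[]/eqP->; rewrite ?eqxx // => _.
    exact: ltnW.
  by rewrite msym ltnW.
have [C [cC uC vC CXZ [CX mC]]] := IHi (ltnW ltic).
pose L y := [set x in X | m [set y; x] < p].
pose U := \bigcup_(y in C :\ u) L y.
have cCu : #|C :\ u| <= c.+1 by have := cardsD1 u C; rewrite uC cC add1n => -[<-]; apply: ltnW.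
have leU : E * #|U| <= c.+1 * (E * p + k * #|X|).
  have : #|U| <= \sum_(y in C :\ u) #|L y| by apply: card_bigcup_le.
  rewrite -(leq_pmul2l E0) => /leq_trans; apply.
  rewrite big_distrr /=.
  apply: (@leq_trans (\sum_(y in C :\ u) (E * p + k * #|X|))).
    by apply: leq_sum => y /(subsetP CXZ); apply: few_light_neighbors.
  by rewrite sum_nat_const leq_mul2r cCu orbT.
have /subsetPn[y] : ~~ (Y \subset Z :|: U).
  apply/negP=> /subset_leq_card leYZU; have := leq_card_setU Z U.
  move: leYZU leU leY ltZ leX.
  move: #|Y| #|Z :|: U| #|Z| #|U| #|X| => a b d f n h1 h2 h3 h4 h5 [h6 _].
  have h7 : E * a <= E * (d + f) by rewrite leq_mul2l (leq_trans h1 h6) orbT.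
  have h8 : E * n <= E * (p + k * a) by rewrite leq_mul2l h3 orbT.
  have h9 : E * d <= E * T by rewrite leq_mul2l (ltnW h4) orbT.
  have h10 : k * (E * a) <= k * (E * T + c.+1 * (E * p + k * n)).
    rewrite leq_mul2l; apply/orP; right; apply: (leq_trans h7).
    by rewrite mulnDr leq_add.
  have h11 : E * n = k * k * c.+1 * n + n by rewrite {1}eqE mulnDl mul1n.
  have h12 : k * (c.+1 * (k * n)) = k * k * c.+1 * n by rewrite !mulnA [k * c.+1 * k]mulnAC.
  move: h5 h8 h10 h11 h12; rewrite !mulnDr; clear; lia.
rewrite in_setU negb_or inE => /andP[yX puy] /andP[yZ /bigcupP yL].
have yC x : x \in C -> p <= m [set x; y].
  move=> xC; have [->//|xu] := eqVneq x u; rewrite leqNgt; apply/negP=> lt_p.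
  by apply: yL; exists x; rewrite !inE ?xu ?xC ?yX.
have ynC : y \notin C by apply/negP=> /yC; rewrite setUid m1 leqNgt p0.
exists (y |: C); split.
- by rewrite cardsU1 ynC cC.
- by rewrite inE uC orbT.
- by rewrite inE vC orbT.
- apply/subsetP=> x; rewrite in_setD1 in_setU1 => /andP[xu /predU1P[->|xC]].
    by rewrite in_setD yZ.
  by apply: (subsetP CXZ); rewrite in_setD1 xu.
split; first by apply/subsetP=> x; rewrite !inE => /predU1P[->//|]; apply: (subsetP CX).
move=> x z; rewrite !inE => /predU1P[->|xC] /predU1P[->|zC]; rewrite ?eqxx //.
- by rewrite msym => _; apply: yC.
- by move=> _; apply: yC.
exact: mC.
Qed.

(** * Embedding under the minimum degree condition *)

Lemma dense_embedding (W : finType) (H : sgraph W) (k p : nat) :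
  2 < chromatic_number H -> #|edges H| = p.+1 -> p < k ->
  2 * (k - p) <= chromatic_number H ->
  exists N, forall (V : finType) (m : {set V} -> nat) (X : {set V}) (u v : V),
    (forall e, m e <= k) -> (forall x, m [set x] = 0) -> min_degree_ge m X p ->
    N <= #|X| -> u \in X -> v \in X -> p < m [set u; v] ->
    exists f : W -> V, greedy_embedding m H f.
Proof.
move=> r2 cH pk q2.
have [a [b [c [bc abH acH]]]] := adjacent_edges r2.
have W0 : 0 < #|W| by apply/card_gt0P; exists a.
have p0 : 0 < p.
  rewrite -ltnS -cH (cardsD1 [set a; b]) abH ltnS; apply/card_gt0P.
  exists [set a; c]; rewrite in_setD1 acH andbT.
  apply: contra_neq bc => /setP/(_ c); rewrite !inE eqxx orbT.
  by rewrite eq_sym (negbTE (edge_neq acH)) => /esym/eqP->.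
(* The order of choices avoids circularity: [E] is fixed first, [N1] depends on [E], and [N2] on
   [N1], the threshold between many and few heavy vertices. *)
have [E few] := few_heavy_clique #|W| p0 pk.
have [N1 many] := heavy_grid_exists E (chromatic_number H).-2 pk W0.
have [N2 {}few] := few N1.
exists (N1 + N2) => V m X u v mk m1 degX leX uX vX heavy.
have [leZ|ltZ] := leqP N1 #|heavy_vertices m X p E|.
  have [|P [w [gridP wP]]] := many V m X mk degX _ leZ; first by lia.
  have r_eq : (chromatic_number H).-2.+2 = chromatic_number H by lia.
  rewrite r_eq in gridP wP.
  exact: (grid_embedding (erefl _) (ltnW r2) cH q2 gridP wP).
have [|C [u' [v' [WC uC vC uv [huv mC]]]]] := few V m X u v mk m1 degX _ ltZ uX vX heavy.
  by lia.
exact: clique_embedding cH WC uC vC uv huv mC.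
Qed.

(** * Deleting vertices of small degree *)

Definition pair_sum (V : finType) (m : {set V} -> nat) (X : {set V}) :=
  \sum_(x in X) \sum_(y in X) m [set x; y].

Lemma degree_le (V : finType) (m : {set V} -> nat) (X : {set V}) (p : nat) (x : V) :
  (forall x, m [set x] = 0) -> x \in X ->
  (forall y, y \in X -> m [set x; y] <= p) ->
  \sum_(y in X) m [set x; y] <= p * #|X|.-1.
Proof.
move=> m1 xX mp; rewrite (big_setD1 x) //= setUid m1 add0n.
rewrite (cardsD1 x) xX add1n /= mulnC -sum_nat_const.
by apply: leq_sum => y; rewrite in_setD1 => /andP[_]; apply: mp.
Qed.

Lemma pair_sum_remove (V : finType) (m : {set V} -> nat) (X : {set V}) (v : V) :
  (forall x, m [set x] = 0) -> v \in X ->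
  pair_sum m X = pair_sum m (X :\ v) + 2 * \sum_(x in X) m [set v; x].
Proof.
move=> m1 vX; rewrite /pair_sum (big_setD1 v) //=.
have -> : \sum_(x in X :\ v) \sum_(y in X) m [set x; y] =
    \sum_(x in X :\ v) m [set x; v] + \sum_(x in X :\ v) \sum_(y in X :\ v) m [set x; y].
  by rewrite -big_split; apply: eq_bigr => x _; rewrite (big_setD1 v).
have -> : \sum_(x in X) m [set v; x] = \sum_(x in X :\ v) m [set x; v].
  rewrite (big_setD1 v) //= setUid m1 add0n.
  by apply: eq_bigr => x _; rewrite setUC.
lia.
Qed.

Lemma min_degree_dec (V : finType) (m : {set V} -> nat) (X : {set V}) (p : nat) :
  min_degree_ge m X p \/
  exists2 v, v \in X & \sum_(x in X) m [set v; x] < p * #|X|.-1.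
Proof.
have [/forall_inP|/forall_inPn[v vX]] :=
  boolP [forall v in X, p * #|X|.-1 <= \sum_(x in X) m [set v; x]]; first by left.
by rewrite -ltnNge; right; exists v.
Qed.

(* Deleting a vertex of degree below [p (n - 1)] increases the surplus over
   [p n (n - 1)]; the surplus on [N] vertices is at most [k N^2]. *)
Lemma pair_sum_le (V : finType) (m : {set V} -> nat) (k p N : nat) :
  (forall e, m e <= k) -> (forall x, m [set x] = 0) ->
  (forall (X : {set V}) u v, min_degree_ge m X p -> N <= #|X| -> u \in X -> v \in X ->
     m [set u; v] <= p) ->
  forall X : {set V}, N + k * N * N <= #|X| -> pair_sum m X <= p * (#|X| * #|X|.-1).
Proof.
move=> mk m1 light X leX.
(* The allowed surplus [k * N * N - j] is truncated at 0, which it reaches by the size assumed for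
   [X]. *)
suff /(_ (#|X| - N) X) : forall j (Y : {set V}), #|Y| = N + j ->
    pair_sum m Y <= p * (#|Y| * #|Y|.-1) + (k * N * N - j) by lia.
elim=> [|j IHj] Y cY.
  rewrite subn0; apply: leq_trans (leq_addl _ _).
  rewrite /pair_sum mulnC -[N in N * _]addn0 -cY -sum_nat_const.
  apply: leq_sum => x _; rewrite mulnC -[N in N * _]addn0 -cY -sum_nat_const.
  by apply: leq_sum => y _.
have [degY|[v vY ltv]] := min_degree_dec m Y p.
  apply: leq_trans (leq_addr _ _); rewrite mulnCA -sum_nat_const.
  apply: leq_sum => x xY; apply: degree_le => // y yY.
  by apply: light degY _ xY yY; lia.
have cYv : #|Y :\ v| = N + j by have := cardsD1 v Y; rewrite vY; lia.
rewrite (pair_sum_remove m1 vY); have := IHj _ cYv.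
move: ltv; rewrite cYv cY addnS /=.
move: (\sum_(x in Y) _) (pair_sum _ _) (k * N * N) (N + j) => d D K n ltd leD.
case: n leD ltd => [|n] /=; nia.
Qed.

(** Deleting a vertex of small degree would leave a set violating [pair_sum_le]; the strict size
    bound leaves room for this one deletion. Hence all degrees are large, no pair exceeds [p], and
    equality holds everywhere. *)
Lemma pair_sum_extremal (V : finType) (m : {set V} -> nat) (k p N : nat) (X : {set V}) :
  (forall e, m e <= k) -> (forall x, m [set x] = 0) ->
  (forall (X : {set V}) u v, min_degree_ge m X p -> N <= #|X| -> u \in X -> v \in X ->
     m [set u; v] <= p) ->
  N + k * N * N < #|X| -> p * (#|X| * #|X|.-1) <= pair_sum m X ->
  {in X &, forall u v, u != v -> m [set u; v] = p}.
Proof.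
move=> mk m1 light ltX leX u v uX vX uv.
have [degX|[z zX ltz]] := min_degree_dec m X p; last first.
  have cXz := cardsD1 z X; rewrite zX in cXz.
  have := @pair_sum_le V m k p N mk m1 light (X :\ z).
  move: leX; rewrite (pair_sum_remove m1 zX) cXz add1n /=.
  move: ltz ltX; rewrite cXz add1n /=.
  move: (\sum_(x in X) _) (pair_sum _ _) #|X :\ z| => d D n ltd ltn h1 h2.
  have {}h2 := h2 ltn; case: n ltn ltd h1 h2 => [|n] /=; nia.
have lep x y : x \in X -> y \in X -> m [set x; y] <= p.
  by apply: light degX _; lia.
apply/eqP; rewrite eqn_leq lep //=; have := degX u uX.
rewrite (big_setD1 u) //= setUid m1 add0n.
rewrite (big_setD1 v) /=; last by rewrite in_setD1 eq_sym uv.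
have := cardsD1 u X; rewrite uX => ->; rewrite add1n /=.
have := cardsD1 v (X :\ u); rewrite in_setD1 eq_sym uv vX /= => ->.
rewrite mulnDr muln1.
have : \sum_(y in X :\ u :\ v) m [set u; y] <= p * #|X :\ u :\ v|.
  rewrite mulnC -sum_nat_const; apply: leq_sum => y.
  by rewrite !in_setD1 => /and3P[_ _]; apply: lep.
lia.
Qed.

(** * Color sets and rigidity of extremal colorings *)

Definition color_set (V : finType) (k : nat) (c : {ffun 'I_k -> sgraph V}) (e : {set V}) :=
  [set i | e \in edges (c i)].

Lemma mult_disjoint_sum (V : finType) (k : nat) (c : {ffun 'I_k -> sgraph V}) e :
  mult (disjoint_sum c) e = #|color_set c e|.
Proof.
rewrite /disjoint_sum /= ffunE -sum1dep_card [RHS]big_mkcond.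
by apply: eq_bigr => i _; case: (e \in _).
Qed.

Lemma color_set_not2 (V : finType) (k : nat) (c : {ffun 'I_k -> sgraph V}) (e : {set V}) :
  #|e| != 2 -> color_set c e = set0.
Proof.
move=> e2; apply/setP=> i; rewrite !inE; apply: contraNF e2.
by have /forall_inP := edges_card2 (c i); apply.
Qed.

Lemma multicolored_of_transversal (V W : finType) (k : nat)
    (c : {ffun 'I_k -> sgraph V}) (H : sgraph W) (f : W -> V) (g : {set W} -> 'I_k) :
  injective f -> {in edges H &, injective g} ->
  (forall e, e \in edges H -> g e \in color_set c (f @: e)) ->
  has_multicolored c H.
Proof.
move=> injf injg gP; apply/existsP; exists [ffun x => f x].
apply/existsP; exists [ffun e : {e | e \in edges H} => g (val e)].
apply/and3P; split.
- by apply/injectiveP=> x y; rewrite !ffunE => /injf.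
- apply/injectiveP=> x y; rewrite !ffunE => /injg eqv.
  by apply: val_inj; apply: eqv; apply: valP.
apply/forallP=> -[e eH]; rewrite ffunE /=.
rewrite (eq_imset (g := f) e) => [|x]; last by rewrite ffunE.
by have := gP e eH; rewrite inE.
Qed.

Lemma multicolored_of_greedy (V W : finType) (k : nat)
    (c : {ffun 'I_k -> sgraph V}) (H : sgraph W) (f : W -> V) :
  0 < k -> greedy_embedding (fun e => #|color_set c e|) H f -> has_multicolored c H.
Proof.
case: k c => // k c _ [injf hallf].
have [g [injg gP]] := greedy_transversal (C := 'I_k.+1) ord0
  (L := fun e : {set W} => color_set c (f @: e)) hallf.
exact: multicolored_of_transversal injf injg gP.
Qed.

(* If the lists of [uv] and [uw] differ, map two adjacent edges of [H] there, use
   a color missing from the second list on the first edge, and finish greedily. *)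
Lemma adjacent_color_sets (V W : finType) (H : sgraph W) (k p : nat)
    (c : {ffun 'I_k -> sgraph V}) (u v w : V) :
  2 < chromatic_number H -> #|edges H| = p.+1 -> #|W| <= #|V| ->
  ~~ has_multicolored c H ->
  (forall x y, x != y -> #|color_set c [set x; y]| = p) ->
  u != v -> u != w -> color_set c [set u; v] = color_set c [set u; w].
Proof.
move=> r2 cH WV noH cp uv uw.
have [->//|vw] := eqVneq v w.
have [a [b [d [bd abH adH]]]] := adjacent_edges r2.
have ab := edge_neq abH; have ad := edge_neq adH.
apply/eqP; rewrite eqEcard !cp // leqnn andbT; apply: contraT => /subsetPn[al alv alw].
case/negP: noH; rewrite -cardsT in WV.
pose g0 x := if x == a then u else if x == b then v else w.
have g0a : g0 a = u by rewrite /g0 eqxx.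
have g0b : g0 b = v by rewrite /g0 eqxx eq_sym (negbTE ab).
have g0d : g0 d = w by rewrite /g0 eq_sym (negbTE ad) eq_sym (negbTE bd).
have [||||f [injf _ fg]] := @injection_extending V W setT [:: a; b; d] g0.
- by rewrite cardsT -cardsT.
- by rewrite /= !inE negb_or ab ad bd.
- move=> x y; rewrite !inE => /or3P[]/eqP-> /or3P[]/eqP->; rewrite ?g0a ?g0b ?g0d //;
    by move/eqP; rewrite 1?(negbTE uv, negbTE uw, negbTE vw) // eq_sym
       1?(negbTE uv, negbTE uw, negbTE vw).
- by [].
have fa : f a = u by rewrite fg ?g0a // !inE eqxx.
have fb : f b = v by rewrite fg ?g0b // !inE eqxx orbT.
have fd : f d = w by rewrite fg ?g0d // !inE eqxx !orbT.
have adab : [set a; d] != [set a; b].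
  apply: contra_neq bd => /setP/(_ d); rewrite !inE eqxx orbT.
  by rewrite eq_sym (negbTE ad) => /esym/eqP->.
pose D := edges H :\ [set a; b].
(* With [al] reserved for [[set a; b]], the other [p] edges keep at least [p - 1] colors each, and
   [[set a; d]] keeps all [p]. So at most [p - 1] lists have size [p - 1], as the greedy choice
   requires. *)
pose L (e : {set W}) := color_set c (f @: e) :\ al.
have cD : #|D| = p by have := cardsD1 [set a; b] (edges H); rewrite abH cH add1n => -[].
have adD : [set a; d] \in D by rewrite in_setD1 adab.
have cf e : e \in edges H -> #|color_set c (f @: e)| = p.
  move=> /edgeP[x [y [xy ->]]]; rewrite imset_pair cp //.
  by rewrite (inj_eq injf).
have Lad : #|L [set a; d]| = p.
  have := cardsD1 al (color_set c (f @: [set a; d])).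
  by rewrite cf // imset_pair fa fd (negbTE alw) add0n /L imset_pair fa fd.
have Lp e : e \in D -> p <= #|L e|.+1.
  rewrite in_setD1 => /andP[_ eH]; rewrite -(cf e eH) (cardsD1 al).
  by rewrite -addn1 addnC leq_add2l leq_b1.
have [|g [injg gP]] := @greedy_transversal _ _ al D L.
  move=> x; have [px|xp] := leqP p x.
    apply: leq_trans px; rewrite -cD; apply/subset_leq_card/subsetP=> e.
    by rewrite inE => /andP[].
  have sub : [set e in D | #|L e| <= x] \subset D :\ [set a; d].
    apply/subsetP=> e; rewrite in_set => /andP[eD Le]; rewrite in_setD1 eD andbT.
    by apply: contraTneq Le => ->; rewrite Lad -ltnNge.
  have [xlt|xge] := ltnP x.+1 p.
    rewrite (_ : [set e in D | _] = set0) ?cards0 //.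
    apply/setP=> e; rewrite in_set in_set0; apply/negP=> /andP[/Lp pL Le].
    by have := leq_trans pL (Le : _ < x.+1); rewrite leqNgt xlt.
  apply: leq_trans (subset_leq_card sub) _.
  by rewrite -ltnS (leq_trans _ xge) // -cD (cardsD1 [set a; d] D) adD.
have gal e : e \in D -> g e != al.
  by move/gP; rewrite in_setD1 => /andP[].
have inD e : e \in edges H -> e != [set a; b] -> e \in D.
  by move=> eH e_ab; rewrite in_setD1 e_ab.
apply: (@multicolored_of_transversal _ _ _ _ _ f
          (fun e => if e == [set a; b] then al else g e)) => //.
  move=> x y xH yH; case: (eqVneq x) => [->|xn]; case: (eqVneq y) => [->|yn] //.
  - by move=> ga; have := gal y (inD _ yH yn); rewrite -ga eqxx.
  - by move=> ga; have := gal x (inD _ xH xn); rewrite ga eqxx.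
  by apply: injg; apply: inD.
move=> e eH; case: eqVneq => [->|en]; first by rewrite imset_pair fa fb.
by have := gP e (inD _ eH en); rewrite in_setD1 => /andP[].
Qed.

(** Any pair [x], [y] is linked to [u], [v] through the pair [x], [u], so equality for adjacent
    pairs spreads to all pairs. A color then contains either every pair or none. *)
Lemma uniform_color_sets (V W : finType) (H : sgraph W) (k p : nat)
    (c : {ffun 'I_k -> sgraph V}) :
  2 < chromatic_number H -> #|edges H| = p.+1 -> #|W| <= #|V| -> 1 < #|V| ->
  ~~ has_multicolored c H ->
  (forall x y, x != y -> #|color_set c [set x; y]| = p) ->
  exists2 S : {set 'I_k}, #|S| = p &
    forall i, c i = if i \in S then complete_graph V else empty_graph V.
Proof.
move=> r2 cH WV V1 noH cp.
have adj := adjacent_color_sets r2 cH WV noH cp.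
have /card_gt1P[u [v [_ _ uv]]] : 1 < #|[set: V]| by rewrite cardsT.
exists (color_set c [set u; v]); first exact: cp.
have eqS x y : x != y -> color_set c [set x; y] = color_set c [set u; v].
  move=> xy; have [xu|xu] := eqVneq x u; first by subst x; apply: adj.
  by rewrite (adj x y u) // setUC; apply: adj; rewrite // eq_sym.
move=> i; apply: val_inj; apply/setP=> e /=.
have [/eqP/cards2P[x [y [xy ->]]]|e2] := eqVneq #|e| 2.
  have -> : ([set x; y] \in edges (c i)) = (i \in color_set c [set x; y]) by rewrite inE.
  by rewrite eqS //; case: ifP => _; rewrite inE // cards2 xy.
have -> : (e \in edges (c i)) = (i \in color_set c e) by rewrite inE.
by rewrite color_set_not2 // inE; case: ifP => _; rewrite inE // (negbTE e2).
Qed.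

(** * Edge counts and colorings by complete graphs *)

Lemma card_ordered_pairs (V : finType) (x y : V) :
  x != y -> #|[set ab : V * V | [set ab.1; ab.2] == [set x; y]]| = 2.
Proof.
move=> xy; rewrite (_ : [set ab | _] = [set (x, y); (y, x)]).
  by rewrite cards2 xpair_eqE negb_and xy.
apply/setP=> -[a b]; rewrite in_set in_set2 !xpair_eqE.
apply/eqP/orP => [/= eqS|[]/andP[/eqP-> /eqP->] //]; last by rewrite setUC.
have eS z : (z == a) || (z == b) = (z == x) || (z == y).
  by rewrite -!in_set2 eqS.
have yx : (y == x) = false by rewrite eq_sym (negbTE xy).
have := eS x; have := eS y; rewrite !eqxx orbT /= => ey /orP[]/eqP ex.
  by move: ey; rewrite -ex yx => /= /eqP->; left; rewrite !eqxx.
by move: ey; rewrite -ex yx orbF => /eqP->; right; rewrite !eqxx.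
Qed.

Lemma pair_sum_edges (V : finType) (m : {set V} -> nat) :
  (forall e : {set V}, #|e| != 2 -> m e = 0) ->
  pair_sum m [set: V] = 2 * \sum_(e : {set V}) m e.
Proof.
move=> m2; rewrite /pair_sum.
transitivity (\sum_(xy : V * V) m [set xy.1; xy.2]).
  rewrite -(pair_bigA _ (fun x y => m [set x; y])) /=.
  apply: eq_big => [x|x _]; first by rewrite inE.
  by apply: eq_bigl => y; rewrite inE.
rewrite (partition_big (fun xy : V * V => [set xy.1; xy.2]) predT) // big_distrr.
apply: eq_bigr => e _.
rewrite (eq_bigr (fun=> m e)); last by move=> xy /andP[_ /eqP->].
have [/eqP/cards2P[x [y [xy ->]]]|/m2->] := eqVneq #|e| 2; last by rewrite big1.
rewrite sum_nat_const -(card_ordered_pairs xy); congr (_ * _).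
by apply: eq_card => ab; rewrite in_set.
Qed.

Lemma double_bin2 n : 2 * 'C(n, 2) = n * n.-1.
Proof. by have := mul_bin_diag n 1; rewrite bin1 => <-. Qed.

Lemma multigraph_ext (V : finType) (G G' : multigraph V) :
  (forall e, mult G e = mult G' e) -> G = G'.
Proof.
case: G G' => [m mP] [m' mP'] /= eqm.
have eqmm : m = m' by apply/ffunP.
by subst m'; congr Multigraph; apply: bool_irrelevance.
Qed.

Lemma mult_complete_colors (V : finType) (k : nat) (c : {ffun 'I_k -> sgraph V})
    (S : {set 'I_k}) (e : {set V}) :
  (forall i, c i = if i \in S then complete_graph V else empty_graph V) ->
  mult (disjoint_sum c) e = #|S| * (#|e| == 2).
Proof.
move=> cS; rewrite mult_disjoint_sum; have [e2|e2] := eqVneq #|e| 2.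
  rewrite muln1; apply: eq_card => i; rewrite inE cS.
  by case: ifP => _; rewrite inE ?e2.
by rewrite muln0 color_set_not2 ?cards0.
Qed.

(** A multicolored copy would inject the edges of [H] into the nonempty colors, all of which lie in
    [S]. *)
Lemma complete_colors_no_multicolored (V W : finType) (H : sgraph W) (k : nat)
    (c : {ffun 'I_k -> sgraph V}) (S : {set 'I_k}) :
  (forall i, c i = if i \in S then complete_graph V else empty_graph V) ->
  #|S| < #|edges H| -> ~~ has_multicolored c H.
Proof.
move=> cS; apply: contraTN => /existsP[f /existsP[g /and3P[_ /injectiveP injg /forallP gP]]].
rewrite -leqNgt; have -> : #|edges H| = #|{: {e | e \in edges H}}| by rewrite card_sig.
rewrite -cardsT -(card_imset _ injg); apply/subset_leq_card/subsetP=> _ /imsetP[e _ ->].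
by have := gP e; rewrite cS; case: ifP => //; rewrite inE.
Qed.

Lemma num_edges_complete_colors (n k : nat) (c : {ffun 'I_k -> sgraph 'I_n})
    (S : {set 'I_k}) :
  (forall i, c i = if i \in S then complete_graph 'I_n else empty_graph 'I_n) ->
  num_edges (disjoint_sum c) = #|S| * 'C(n, 2).
Proof.
move=> cS; rewrite /num_edges (eq_bigr _ (fun e _ => mult_complete_colors e cS)).
rewrite -big_distrr /=; congr (_ * _).
rewrite -[n in RHS](card_ord n) -(card_draws 'I_n 2) -sum1dep_card big_mkcond.
by rewrite [RHS]big_mkcond; apply: eq_bigr => e _; case: (_ == 2).
Qed.

(** * The edge bound and its equality case *)

Lemma num_edges_bound (W : finType) (H : sgraph W) (k p : nat) :
  2 < chromatic_number H -> #|edges H| = p.+1 -> p < k ->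
  2 * (k - p) <= chromatic_number H ->
  exists n0, forall n, n0 <= n -> forall c : {ffun 'I_k -> sgraph 'I_n},
    ~~ has_multicolored c H ->
    num_edges (disjoint_sum c) <= p * 'C(n, 2) /\
    (p * 'C(n, 2) <= num_edges (disjoint_sum c) ->
      exists2 S : {set 'I_k}, #|S| = p &
        forall i, c i = if i \in S then complete_graph 'I_n else empty_graph 'I_n).
Proof.
move=> r2 cH pk q2; have [N emb] := dense_embedding r2 cH pk q2.
(* The first two terms serve the deletion argument, [#|W|] makes room for [H], and the 2 gives both
   the strict size bound of the equality case and two distinct vertices. *)
exists (N + k * N * N + #|W| + 2) => n len c noH.
pose m e := #|color_set c e|.
have mk e : m e <= k by rewrite -[k in _ <= k]card_ord max_card.
have m1 x : m [set x] = 0 by rewrite /m color_set_not2 ?cards0 // cards1.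
have light (X : {set 'I_n}) u v : min_degree_ge m X p -> N <= #|X| ->
    u \in X -> v \in X -> m [set u; v] <= p.
  move=> degX leX uX vX; rewrite leqNgt; apply: contra noH => heavy.
  have [f fP] := emb _ m X u v mk m1 degX leX uX vX heavy.
  by apply: (multicolored_of_greedy _ fP); lia.
have cT : #|[set: 'I_n]| = n by rewrite cardsT card_ord.
have num2 : 2 * num_edges (disjoint_sum c) = pair_sum m [set: 'I_n].
  rewrite pair_sum_edges => [|e e2]; last by rewrite /m color_set_not2 ?cards0.
  by congr (2 * _); apply: eq_bigr => e _; rewrite mult_disjoint_sum.
have double_bound : 2 * (p * 'C(n, 2)) = p * (#|[set: 'I_n]| * #|[set: 'I_n]|.-1).
  by rewrite cT -double_bin2 mulnCA.
split=> [|lenum].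
  rewrite -(@leq_pmul2l 2) // num2 double_bound.
  by apply: (pair_sum_le mk m1 light); rewrite cT; lia.
apply: (uniform_color_sets r2 cH) => //; rewrite ?card_ord; try lia.
move=> x y xy; apply: (pair_sum_extremal mk m1 light (X := setT)); rewrite ?inE //.
  by rewrite cT; lia.
by rewrite -double_bound -num2 leq_mul2l.
Qed.

Theorem theorem6p1 (W : finType) (H : sgraph W) (h r k : nat) :
  #|edges H| = h ->
  chromatic_number H = r ->
  3 <= r ->
  h <= k <= h + r./2 - 1 ->
  exists n0 : nat, forall n : nat, n0 <= n ->
    [/\ exk k n H = (h - 1) * 'C(n, 2),
        exists! G : multigraph 'I_n, extremal_multigraph k H G
      & forall (G : multigraph 'I_n) (c : {ffun 'I_k -> sgraph 'I_n}),
          extremal_coloring H G c <->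
          simple_coloring G c /\
          exists2 S : {set 'I_k}, #|S| = h - 1 &
            forall i : 'I_k,
              c i = if i \in S then complete_graph 'I_n else empty_graph 'I_n].
Proof.
move=> cH chiH r3 /andP[hk kh].
have h0 : 0 < h.
  have [|a [b [_ [_ abH _]]]] := @adjacent_edges W H; first by rewrite chiH.
  by rewrite -cH; apply/card_gt0P; exists [set a; b].
case: h h0 => // p _ in cH hk kh *; rewrite subn1 /=.
(* With [h = p.+1], the upper bound on [k] reads [k - p <= r./2], hence [2 * (k - p) <= r]. *)
have [|||n0 bound] := @num_edges_bound W H k p _ cH; rewrite ?chiH //; first by lia.
exists n0 => n /bound{}bound.
have [S0 _ cS0] : exists2 S : {set 'I_k}, S \subset setT & #|S| = p.
  by apply: exists_subset_card; rewrite cardsT card_ord ltnW.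
pose c0 := [ffun i => if i \in S0 then complete_graph 'I_n else empty_graph 'I_n].
have c0S i : c0 i = if i \in S0 then complete_graph 'I_n else empty_graph 'I_n.
  by rewrite ffunE.
have exE : exk k n H = p * 'C(n, 2).
  apply/eqP; rewrite eqn_leq; apply/andP; split.
    have [|G [c [-> noH <-]]] := @exk_attained k n W H; first by rewrite cH.
    by have [] := bound c noH.
  rewrite -cS0 -(num_edges_complete_colors c0S).
  by apply: exk_upper => //; apply: complete_colors_no_multicolored c0S _; rewrite cS0 cH.
have char (G : multigraph 'I_n) (c : {ffun 'I_k -> sgraph 'I_n}) :
    extremal_coloring H G c <-> simple_coloring G c /\
      exists2 S : {set 'I_k}, #|S| = p &
        forall i, c i = if i \in S then complete_graph 'I_n else empty_graph 'I_n.
  split=> [[Gc noH numG]|[Gc [S cS cE]]]; split=> //.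
  - by have [_] := bound c noH; apply; rewrite -Gc numG exE.
  - by apply: complete_colors_no_multicolored cE _; rewrite cS cH.
  - by rewrite Gc (num_edges_complete_colors cE) cS exE.
split=> //; exists (disjoint_sum c0); split.
  by exists c0; apply/char; split=> //; exists S0.
(* The sets [S] and [S0] of nonempty colors may differ; only their common size [p] enters the
   multiplicities. *)
move=> G [c /char[-> [S cS cE]]]; apply: multigraph_ext => e.
by rewrite (mult_complete_colors e c0S) (mult_complete_colors e cE) cS0 cS.
Qed.
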